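(* Let $a$ be a complex number (in particular, any integer) and $n\ge1$ an integer. Then $$\det_{0\le i,j\le n-1}\left(\binom{2i+2j+a}{i}-\binom{2i+2j+a}{i-1}\right)=2^{\binom n2}.$$
   Context: For a complex number $N$ and an integer $k$, the binomial coefficient is $\binom{N}{k}=\frac{N(N-1)\cdots(N-k+1)}{k!}$ if $k\ge0$ and $\binom Nk=0$ if $k<0$. *)

(* Defs.v *)
From mathcomp Require Import all_boot all_order all_algebra.
From mathcomp Require Import reals complex.
Set Implicit Arguments.
Unset Strict Implicit.
Unset Printing Implicit Defensive.
Import GRing.Theory Num.Theory.
Local Open Scope ring_scope.

Definition gbinom (F : numFieldType) (N : F) (k : int) : F :=
  match k with
  | Posz m => (\prod_(l < m) (N - l%:R)) / m`!%:R
  | Negz _ => 0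
  end.

(* Main.v *)
(** For fixed [i] the [i]-th row is [p_i(j)], where [p_i] is a polynomial of
    degree [i] with leading coefficient [2 ^ i / i!]. The determinant is
    therefore the product of these leading coefficients times the Vandermonde
    determinant at [0, ..., n - 1], which is the product of the [i!]. *)
Require Import Defs.
From mathcomp Require Import all_boot all_order all_algebra.
From mathcomp Require Import reals complex.
Set Implicit Arguments.
Unset Strict Implicit.
Unset Printing Implicit Defensive.
Import GRing.Theory Num.Theory.
Local Open Scope ring_scope.
Local Open Scope complex_scope.

Lemma det_horner_Vandermonde (R : comNzRingType) (n : nat)
    (p : 'I_n -> {poly R}) (x : 'rV[R]_n) :
  (forall i : 'I_n, size (p i) <= i.+1)%N ->
  \det (\matrix_(i, j) (p i).[x 0 j])
  = (\prod_i (p i)`_i) * \det (Vandermonde n x).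
Proof.
move=> size_p; pose L : 'M[R]_n := \matrix_(i, k) (p i)`_k.
have -> : \matrix_(i, j) (p i).[x 0 j] = L *m Vandermonde n x.
  apply/matrixP => i j; rewrite !mxE.
  rewrite (horner_coef_wide _ (leq_trans (size_p i) (ltn_ord i))).
  by apply: eq_bigr => k _; rewrite !mxE.
rewrite det_mulmx det_trig; first by congr (_ * _); apply: eq_bigr => i _;
  rewrite mxE.
apply/is_trig_mxP => i k lt_ik; rewrite mxE nth_default //.
exact: leq_trans (size_p i) lt_ik.
Qed.

(** Grouping the differences [j - i] by the larger index [j] gives [j (j - 1) ... 1] for each
    [j]. *)
Lemma det_Vandermonde_nat (R : comNzRingType) (n : nat) :
  \det (Vandermonde n (\row_(j < n) j%:R : 'rV[R]_n))
  = \prod_(j < n) (j`!)%:R.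
Proof.
rewrite det_Vandermonde.
under eq_bigr => i _ do under eq_bigr => j _ do rewrite !mxE.
rewrite (exchange_big_dep xpredT) //=; apply: eq_bigr => j _.
(* The factorial is read in descending order, so that its factor number [i] is [j - i]. *)
rewrite fact_prod natr_prod big_add1 /= big_rev_mkord subn0.
rewrite -(big_ord_widen_cond _ xpredT (fun i => j%:R - i%:R)) ?(ltnW (ltn_ord j)) //.
apply: eq_bigr => i _.
by rewrite -natrB ?(ltnW (ltn_ord i)) // subnSK.
Qed.

(** This is the binomial of [2 x + c] over [m] as a polynomial in [x]. Pulling [2] out of each
    factor leaves a monic product, which exposes the degree and the leading coefficient. *)
Definition gbinom_poly (F : numFieldType) (c : F) (m : nat) : {poly F} :=
  (2 ^+ m / m`!%:R) *: \prod_(l < m) ('X - ((l%:R - c) / 2)%:P).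

Lemma horner_gbinom_poly (F : numFieldType) (c : F) (m : nat) (x : F) :
  (gbinom_poly c m).[x] = gbinom (2 * x + c) m%:Z.
Proof.
rewrite /gbinom_poly /gbinom hornerZ horner_prod mulrAC; congr (_ / _).
rewrite -{1}[m]card_ord -prodr_const -big_split /=; apply: eq_bigr => l _.
by rewrite hornerXsubC mulrBr mulrCA divff ?pnatr_eq0 // mulr1 opprB addrA.
Qed.

Lemma size_gbinom_poly (F : numFieldType) (c : F) (m : nat) :
  (size (gbinom_poly c m) <= m.+1)%N.
Proof.
apply: leq_trans (size_scale_leq _ _) _.
by rewrite size_prod_XsubC /index_enum -enumT size_enum_ord.
Qed.

Lemma coef_gbinom_poly (F : numFieldType) (c : F) (m : nat) :
  (gbinom_poly c m)`_m = 2 ^+ m / m`!%:R.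
Proof.
rewrite coefZ; set q := \prod_(l < m) _.
have size_q : size q = m.+1.
  by rewrite size_prod_XsubC /index_enum -enumT size_enum_ord.
have /monicP : q \is monic by apply: monic_prod_XsubC.
by rewrite /lead_coef size_q /= => ->; rewrite mulr1.
Qed.

Lemma det_gbinom_sub (F : numFieldType) (a : F) (n : nat) :
  \det (\matrix_(i < n, j < n)
          (gbinom ((2 * i + 2 * j)%:R + a) i%:Z
           - gbinom ((2 * i + 2 * j)%:R + a) (i%:Z - 1)))
  = 2 ^+ 'C(n, 2).
Proof.
(* In row [i] the upper argument is [2 j + c i], with [c i] independent of [j]. *)
pose c (i : nat) : F := (2 * i)%:R + a.
pose p (i : nat) : {poly F} :=
  gbinom_poly (c i) i - (if i is k.+1 then gbinom_poly (c i) k else 0).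
have size_p i : (size (p i) <= i.+1)%N.
  case: i => [|k]; rewrite /p; first by rewrite subr0 size_gbinom_poly.
  rewrite (leq_trans (size_polyD _ _)) // geq_max size_gbinom_poly size_polyN.
  exact: leq_trans (size_gbinom_poly _ _) _.
have coef_p i : (p i)`_i = 2 ^+ i / i`!%:R.
  case: i => [|k]; rewrite /p coefB coef_gbinom_poly ?coef0 ?subr0 //.
  (* The subtracted polynomial has degree at most [k], so it does not reach the coefficient of index
     [k.+1]. *)
  by rewrite [X in _ - X]nth_default ?subr0 ?size_gbinom_poly.
pose x : 'rV[F]_n := \row_(j < n) j%:R.
transitivity (\det (\matrix_(i < n, j < n) (p i).[x 0 j])).
  congr (\det _); apply/matrixP => i j; rewrite !mxE.
  have -> : (2 * i + 2 * j)%:R + a = 2 * j%:R + c i.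
    by rewrite /c addrA -natrM -natrD addnC.
  (* In row 0 the lower index [-1] makes the second binomial 0, matching the zero polynomial in
     [p 0]. *)
  case: (nat_of_ord i) => [|k]; rewrite /p hornerD hornerN horner_gbinom_poly.
    by rewrite horner0.
  by rewrite horner_gbinom_poly -[k.+1]addn1 PoszD addrK.
rewrite det_horner_Vandermonde // det_Vandermonde_nat -big_split /=.
under eq_bigr => i _ do rewrite coef_p divfK ?pnatr_eq0 -?lt0n ?fact_gt0 //.
(* The exponents of [2] add up to [0 + 1 + ... + (n - 1)]. *)
by rewrite prodrXr -bin2_sum big_mkord.
Qed.

Theorem theorem4 (R : realType) (a : R[i]) (n : nat) (hn : (1 <= n)%N) :
  \det (\matrix_(i < n, j < n)
          (gbinom ((2 * i + 2 * j)%:R + a) i%:Z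
           - gbinom ((2 * i + 2 * j)%:R + a) (i%:Z - 1)))
  = 2 ^+ 'C(n, 2).
Proof. exact: det_gbinom_sub. Qed.
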